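(* Let $M\ge 1$ and $1\le N_s\le 2^{M-1}$ be integers, and let the binary expansion of $N_s-1$ be $\sum_{i=1}^{k}2^{r_i}$ with $r_1>r_2>\cdots>r_k\ge 0$ (with $k=0$ if $N_s=1$). Then the $N_s$-th vertex in level $M$ of the S-tree is the same fraction as the $N_c$-th vertex in level $M$ of the Calkin-Wilf tree, where $$N_c=\begin{cases}1+\displaystyle\sum_{j=1}^{k/2}\left(2^{r_{2j-1}+1}-2^{r_{2j}+1}\right), & 2\mid k,\\[2mm] 1+2^{M}-2^{r_1+1}+\displaystyle\sum_{j=1}^{(k-1)/2}\left(2^{r_{2j}+1}-2^{r_{2j+1}+1}\right), & 2\nmid k.\end{cases}$$
   Context: The S-tree is the infinite binary tree of fractions defined as follows. Level 0 consists of the single vertex $\frac{1}{1}$, which has exactly one child, $\frac{1}{2}$, in level 1. Every vertex $\frac{m}{n}$ in level $k\ge 1$ has a left child $\frac{m}{m+n}$ and a right child $\frac{n}{m+n}$ in level $k+1$. The Calkin-Wilf tree is the infinite binary tree with root $\frac11$ at level 0 in which every vertex $\frac ab$ has left child $\frac{a}{a+b}$ and right child $\frac{a+b}{b}$ in the next level. In both trees the vertices of a level are counted from the left, starting at 1. *)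

(* Defs.v *)
From mathcomp Require Import all_boot all_order all_algebra.

Set Implicit Arguments.
Unset Strict Implicit.
Unset Printing Implicit Defensive.

Import GRing.Theory.

(* The pair (m, n) stands for the fraction m/n. The children of a vertex are   *)
(* computed from its numerator and denominator as they stand, without          *)
(* cancellation; every vertex of either tree is in lowest terms, so two        *)
(* vertices have the same value exactly when they are the same pair.           *)
Definition fraction : Type := (nat * nat)%type.

Definition S_children (x : fraction) : seq fraction :=
  let: (m, n) := x in [:: (m, m + n); (n, m + n)].

Definition CW_children (x : fraction) : seq fraction :=
  let: (a, b) := x in [:: (a, a + b); (a + b, b)].

Definition next_level (children : fraction -> seq fraction)
    (l : seq fraction) : seq fraction :=
  flatten [seq children x | x <- l].

(* The root of the S-tree has a single child, so the doubling starts at        *)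
(* level 1.                                                                    *)
Definition S_level (k : nat) : seq fraction :=
  if k is k'.+1 then iter k' (next_level S_children) [:: (1, 2)]
  else [:: (1, 1)].

Definition CW_level (k : nat) : seq fraction :=
  iter k (next_level CW_children) [:: (1, 1)].

(* Positions are counted from 1; there is no vertex at position 0 or beyond    *)
(* the end of the level.                                                       *)
Definition vertex (level : seq fraction) (N : nat) : option fraction :=
  if N is N'.+1 then onth level N' else None.

(* The exponents are r 1, ..., r k; the values of r outside 1..k are unused.   *)
(* The formula is an integer, so that no subtraction of powers is truncated.   *)
Definition CW_position (M k : nat) (r : nat -> nat) : int :=
  if 2 %| k then
    (1 + \sum_(1 <= j < (k %/ 2).+1)
           (2 ^+ (r (2 * j - 1)%N + 1) - 2 ^+ (r (2 * j)%N + 1)))%R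
  else
    (1 + 2 ^+ M - 2 ^+ (r 1%N + 1)
       + \sum_(1 <= j < ((k - 1) %/ 2).+1)
           (2 ^+ (r (2 * j)%N + 1) - 2 ^+ (r (2 * j + 1)%N + 1)))%R.

(* Main.v *)
(* Write n = N_s - 1 in binary and let p = N_c - 1.  The alternating formula    *)
(* turns into two rules for appending a last bit to n, that is, for going down  *)
(* one level in the S-tree: appending 0 replaces p by 2p, appending 1 replaces  *)
(* p by 2(2^M - 1 - p).  In the Calkin-Wilf tree the first rule takes the left  *)
(* child a/(a+b) of a/b; the second takes the mirror image of the vertex, which *)
(* is b/a, and then its left child b/(a+b).  These are the two S-children.      *)
Require Import Defs.
From mathcomp Require Import all_boot all_order all_algebra.
From mathcomp Require Import zify ring.

Set Implicit Arguments.
Unset Strict Implicit.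
Unset Printing Implicit Defensive.

Import GRing.Theory.

(** Both rules come from reading the formula recursively in [k]. By [CW_positionS], one further
    exponent [e] sends [p] to [2^M - 2^(e+1) - p]; by [CW_position_shift], raising [M] and all
    exponents by one doubles [p]. A final bit 1 is a shift followed by [e = 0]. [CW_level_mirror]
    explains the reflection inside the Calkin-Wilf tree, and [S_vertex_in_CW] joins the two sides by
    induction on the level. *)

Section BinaryLevels.

Variables (children : fraction -> seq fraction) (f g : fraction -> fraction).
Hypothesis childrenE : forall x, children x = [:: f x; g x].

Lemma onth_next_level_even l i :
  onth (next_level children l) i.*2 = omap f (onth l i).
Proof.
rewrite /next_level; elim: l i => [|x l IHl] [|i] //=; rewrite childrenE //.
exact: IHl.
Qed.

Lemma onth_next_level_odd l i :
  onth (next_level children l) i.*2.+1 = omap g (onth l i).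
Proof.
rewrite /next_level; elim: l i => [|x l IHl] [|i] //=; rewrite childrenE //.
exact: IHl.
Qed.

End BinaryLevels.

(** Left children are formed alike in both trees, so this map serves for both. *)
Definition S_left (x : fraction) : fraction := (x.1, x.1 + x.2).
Definition S_right (x : fraction) : fraction := (x.2, x.1 + x.2).
Definition CW_right (x : fraction) : fraction := (x.1 + x.2, x.2).

Lemma S_childrenE x : S_children x = [:: S_left x; S_right x].
Proof. by case: x. Qed.

Lemma CW_childrenE x : CW_children x = [:: S_left x; CW_right x].
Proof. by case: x. Qed.

Definition swap (x : fraction) : fraction := (x.2, x.1).

(** Swapping numerator and denominator exchanges the two child maps:
    [swap (S_left x) = CW_right (swap x)]. Since [p + q] is odd below the root, mirror positions are
    children of opposite kinds of mirror parents. *)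
Lemma CW_level_mirror M p q x : p + q = (2 ^ M).-1 ->
  onth (CW_level M) p = Some x -> onth (CW_level M) q = Some (swap x).
Proof.
elim: M p q x => [|M IHM] p q x.
  by case: p q => [|p] [|q] //= _ [<-].
have pow_gt0 : 0 < 2 ^ M by rewrite expn_gt0.
rewrite /CW_level iterS -/(CW_level M) expnS => pqE.
have := odd_double_half p; case: (odd p) => /= pE.
- rewrite -pE add1n (onth_next_level_odd CW_childrenE).
  have -> : q = ((2 ^ M).-1 - p./2).*2 by lia.
  rewrite (onth_next_level_even CW_childrenE).
  case Ey: (onth _ p./2) => [y|] //= [<-].
  rewrite (IHM p./2 _ y) //=; last by lia.
  by rewrite /S_left /swap /CW_right /= addnC.
- rewrite -pE add0n (onth_next_level_even CW_childrenE).
  have -> : q = ((2 ^ M).-1 - p./2).*2.+1 by lia.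
  rewrite (onth_next_level_odd CW_childrenE).
  case Ey: (onth _ p./2) => [y|] //= [<-].
  rewrite (IHM p./2 _ y) //=; last by lia.
  by rewrite /S_left /swap /CW_right /= addnC.
Qed.

(** Together the two sums telescope. This rewrites the odd case of the formula with the pairing of
    the even case, cancelling the term in [r 1]. *)
Lemma telescope_pairs (a : nat -> int) h :
  (\sum_(1 <= j < h.+1) (a (2 * j)%N - a (2 * j + 1)%N) =
   a 1%N - a (2 * h + 1)%N -
   \sum_(1 <= j < h.+1) (a (2 * j - 1)%N - a (2 * j)%N))%R.
Proof.
elim: h => [|h IHh]; first by rewrite !big_nil subrr subr0.
rewrite !(big_nat_recr h.+1) //= IHh.
have -> : 2 * h.+1 - 1 = 2 * h + 1 by lia.
by ring.
Qed.

Lemma CW_position_even M h r : CW_position M (2 * h) r =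
  (1 + \sum_(1 <= j < h.+1)
     (2 ^+ (r (2 * j - 1)%N + 1) - 2 ^+ (r (2 * j)%N + 1)))%R.
Proof. by rewrite /CW_position dvdn_mulr // mulKn. Qed.

Lemma CW_position_odd M h r : CW_position M (2 * h + 1) r =
  (1 + 2 ^+ M - 2 ^+ (r (2 * h + 1)%N + 1) - \sum_(1 <= j < h.+1)
     (2 ^+ (r (2 * j - 1)%N + 1) - 2 ^+ (r (2 * j)%N + 1)))%R.
Proof.
rewrite /CW_position dvdn2 oddD oddM /= addnK mulKn //.
by rewrite (telescope_pairs (fun i => 2 ^+ (r i + 1))%R); ring.
Qed.

Lemma CW_position0 M r : CW_position M 0 r = 1%R.
Proof. by rewrite (CW_position_even M 0) big_nil addr0. Qed.

(** One step in [k] switches between the two cases, which contain the same sum with opposite signs;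
    adding them cancels it. *)
Lemma CW_positionS M k r :
  (CW_position M k.+1 r =
   2 + 2 ^+ M - 2 ^+ (r k.+1 + 1) - CW_position M k r)%R.
Proof.
have := odd_double_half k; case: (odd k) => /= <-.
- have -> : (1 + k./2.*2).+1 = 2 * k./2.+1 by lia.
  have -> : 1 + k./2.*2 = 2 * k./2 + 1 by lia.
  rewrite CW_position_even CW_position_odd big_nat_recr //=.
  have -> : 2 * k./2.+1 - 1 = 2 * k./2 + 1 by lia.
  by ring.
- have -> : (0 + k./2.*2).+1 = 2 * k./2 + 1 by lia.
  have -> : 0 + k./2.*2 = 2 * k./2 by lia.
  by rewrite CW_position_even CW_position_odd; ring.
Qed.

(** Every power of two in the formula doubles, so the position minus 1 doubles. *)
Lemma CW_position_shift M k r r' :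
  (forall i, 1 <= i -> i <= k -> r i = (r' i).+1) ->
  (CW_position M.+1 k r = 2 * CW_position M k r' - 1)%R.
Proof.
elim: k => [|k IHk] rE; first by rewrite !CW_position0.
rewrite !CW_positionS IHk => [|i i_gt0 le_ik]; last by rewrite rE // leqW.
by rewrite rE // addSn !exprS; ring.
Qed.

Lemma sum_pow2_shift k r r' :
  (forall i, 1 <= i -> i <= k -> r i = (r' i).+1) ->
  \sum_(1 <= i < k.+1) 2 ^ r i = (\sum_(1 <= i < k.+1) 2 ^ r' i).*2.
Proof.
move=> rE; rewrite -mul2n big_distrr; apply: eq_big_nat => i /andP[i_gt0 le_ik].
by rewrite rE // expnS.
Qed.

(* Levels are numbered from M.+1 since the doubling of the S-tree starts at     *)
(* level 1.                                                                     *)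
Lemma S_vertex_in_CW M k r :
    (forall i j, 1 <= i -> i < j -> j <= k -> r j < r i) ->
    \sum_(1 <= i < k.+1) 2 ^ r i < 2 ^ M ->
  exists p x,
    [/\ p < 2 ^ M.+1, CW_position M.+1 k r = Posz p.+1,
        onth (S_level M.+1) (\sum_(1 <= i < k.+1) 2 ^ r i) = Some x &
        onth (CW_level M.+1) p = Some x].
Proof.
elim: M k r => [|M IHM] k r r_decr lt_n.
  (* A sum below [2 ^ 0] has no terms, leaving the first vertex 1/2 of level 1. *)
  case: k lt_n {r_decr} => [_|k].
    by rewrite big_nil CW_position0; exists 0, (1, 2).
  have : 0 < 2 ^ r k.+1 by rewrite expn_gt0.
  by rewrite big_nat_recr //=; lia.
have SE : S_level M.+2 = next_level S_children (S_level M.+1) by [].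
have CWE : CW_level M.+2 = next_level CW_children (CW_level M.+1) by [].
(* The bound [k'] is free because a last bit 1 removes the exponent 0 before the shift, while a last
   bit 0 keeps all exponents. *)
have r'_decr k' : k' <= k -> (forall i, 1 <= i -> i <= k' -> 0 < r i) ->
    forall i j, 1 <= i -> i < j -> j <= k' -> (r j).-1 < (r i).-1.
  move=> le_k r_gt0 i j i_gt0 lt_ij le_jk.
  have := r_decr i j i_gt0 lt_ij (leq_trans le_jk le_k).
  by have := r_gt0 j (ltn_trans i_gt0 lt_ij) le_jk; lia.
have shiftE k' : (forall i, 1 <= i -> i <= k' -> 0 < r i) ->
    forall i, 1 <= i -> i <= k' -> r i = (r i).-1.+1.
  by move=> r_gt0 i i_gt0 le_ik; rewrite prednK // r_gt0.
(* The exponents decrease, so the last bit is 1 exactly when the last exponent exists and is 0. *)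
have [/andP[k_gt0 /eqP rk0]|rk_neq0] := boolP ((0 < k) && (r k == 0)).
- case: k k_gt0 rk0 r_decr lt_n r'_decr => // k _ rk0 r_decr lt_n r'_decr.
  have r_gt0 i : 1 <= i -> i <= k -> 0 < r i.
    by move=> i_gt0 le_ik; have := r_decr i k.+1 i_gt0 le_ik (leqnn _); lia.
  move: lt_n; have -> : \sum_(1 <= i < k.+2) 2 ^ r i =
      (\sum_(1 <= i < k.+1) 2 ^ (r i).-1).*2.+1.
    by rewrite big_nat_recr //= rk0 (sum_pow2_shift (shiftE _ r_gt0)) addn1.
  rewrite expnS => lt_n.
  have [|p [x [lt_p pE Sx CWx]]] := IHM k _ (r'_decr k (leqnSn _) r_gt0).
    by lia.
  (* Left child of the mirror image of position [p]; the bound [lt_p] keeps the subtraction from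
     truncating. *)
  exists ((2 ^ M.+1).-1 - p).*2, (S_right x); split.
  + by rewrite (expnS 2 M.+1); lia.
  + rewrite CW_positionS (CW_position_shift _ (shiftE _ r_gt0)) pE rk0.
    rewrite (exprS _ M.+1).
    have <- : Posz (2 ^ M.+1) = (2 ^+ M.+1)%R by rewrite -natrX natz.
    by lia.
  + by rewrite SE (onth_next_level_odd S_childrenE) Sx.
  + rewrite CWE (onth_next_level_even CW_childrenE).
    rewrite (CW_level_mirror _ CWx) /=; last by lia.
    by rewrite /S_left /S_right /swap /= addnC.
- have r_gt0 i : 1 <= i -> i <= k -> 0 < r i.
    move=> i_gt0; rewrite leq_eqVlt => /predU1P[iE|lt_ik].
      by move: rk_neq0; rewrite -iE i_gt0 lt0n.
    by have := r_decr i k i_gt0 lt_ik (leqnn _); lia.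
  move: lt_n; rewrite (sum_pow2_shift (shiftE _ r_gt0)) expnS => lt_n.
  have [|p [x [lt_p pE Sx CWx]]] := IHM k _ (r'_decr k (leqnn _) r_gt0).
    by lia.
  exists p.*2, (S_left x); split.
  + by rewrite (expnS 2 M.+1); lia.
  + by rewrite (CW_position_shift _ (shiftE _ r_gt0)) pE; lia.
  + by rewrite SE (onth_next_level_even S_childrenE) Sx.
  + by rewrite CWE (onth_next_level_even CW_childrenE) CWx.
Qed.

Theorem theorem18 (M Ns k : nat) (r : nat -> nat)
    (hM : 1 <= M) (hNs : 1 <= Ns <= 2 ^ (M - 1))
    (r_decr : forall i j : nat, 1 <= i -> i < j -> j <= k -> r j < r i)
    (r_exp : Ns - 1 = \sum_(1 <= i < k.+1) 2 ^ r i) :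
  exists (Nc : nat) (x : fraction),
    [/\ Posz Nc = CW_position M k r,
        vertex (S_level M) Ns = Some x &
        vertex (CW_level M) Nc = Some x].
Proof.
case: M hM hNs => // M _; rewrite subn1 /= => /andP[Ns_gt0 le_Ns].
have [|p [x [_ pE Sx CWx]]] := @S_vertex_in_CW M k r r_decr.
  by rewrite -r_exp; lia.
exists p.+1, x; split=> //.
by rewrite -Sx -r_exp; case: Ns Ns_gt0 {le_Ns r_exp} => // n _; rewrite subn1.
Qed.
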